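(* Let $\gamma_1,\delta_1,\gamma_2,\delta_2$ be positive integers with $\gamma_1=\gamma_2=\gamma$, and let $\Pi$ be the transition operator of the restricted immediate exchange model $RIEM(\gamma_1,\delta_1;\gamma_2,\delta_2)$. Then: (1) For each $\alpha\in\{+,-,0\}$, $\Pi$ commutes with $J^{\alpha,\gamma_1+\delta_1}_1+J^{\alpha,\gamma_2+\delta_2}_2$ on functions on $\{0,\dots,\gamma_1+\delta_1\}\times\{0,\dots,\gamma_2+\delta_2\}$. (2) $RIEM(\gamma,\delta_1;\gamma,\delta_2)$ is self-dual with self-duality function $D(k_1,k_2;n_1,n_2)=d_{\gamma+\delta_1}(k_1,n_1)\,d_{\gamma+\delta_2}(k_2,n_2)$, where $$d_r(k,n)=\begin{cases}1 & \text{if } k=0,\\ 0 & \text{if } k>n \text{ or } n>r,\\ \binom{n}{k}\big/\binom{r}{k} & \text{otherwise.}\end{cases}$$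
   Context: Model $RIEM(\gamma_1,\delta_1;\gamma_2,\delta_2)$ (for $\gamma_1=\gamma_2$): the state space is $S=\{0,\dots,\gamma_1+\delta_1\}\times\{0,\dots,\gamma_2+\delta_2\}$. Given $(n_1,n_2)\in S$, let $k_1,k_2$ be independent, where $k_i$ has the hypergeometric distribution with parameters $n_i,\gamma_i,\delta_i$: $$\mathbb P(k_i=m)=\frac{\binom{\gamma_i}{m}\binom{\delta_i}{n_i-m}}{\binom{\gamma_i+\delta_i}{n_i}},\qquad 0\le m\le \min(n_i,\gamma_i),$$ with $\binom{a}{b}=0$ if $a<b$. The wealths are split as $(k_1,n_1-k_1;k_2,n_2-k_2)$, the parts $k_1$ and $k_2$ are exchanged, and the two parts of each agent are added, giving $(k_2+n_1-k_1,\;k_1+n_2-k_2)$. The one-step transition operator on functions $f:S\to\mathbb R$ is $$\Pi f(n_1,n_2)=\mathbb E\, f(k_2+n_1-k_1,\;k_1+n_2-k_2).$$ Operators: for a positive integer $\gamma$ and $f:\{0,\dots,\gamma\}\to\mathbb R$, $$J^{+,\gamma}f(n)=(\gamma-n)f(n+1),\quad J^{-,\gamma}f(n)=n f(n-1),\quad J^{0,\gamma}f(n)=\left(\tfrac{\gamma}{2}-n\right)f(n),$$ with $J^{+,\gamma}f(\gamma)=0$ and $J^{-,\gamma}f(0)=0$. $J^{\alpha,\gamma}_i$ denotes $J^{\alpha,\gamma}$ acting on the $i$-th variable of a function of two variables. Self-duality with function $D$ means: for all $(k_1,k_2),(n_1,n_2)\in S$, $\big(\Pi D(\cdot\,;n_1,n_2)\big)(k_1,k_2)=\big(\Pi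 D(k_1,k_2;\cdot)\big)(n_1,n_2)$. *)

(* Defs.v *)
From HB Require Import structures.
From mathcomp Require Import all_boot all_order all_algebra.
From mathcomp Require Import reals.

Set Implicit Arguments.
Unset Strict Implicit.
Unset Printing Implicit Defensive.

Import Order.TTheory GRing.Theory Num.Theory.
Local Open Scope ring_scope.

(* The guard on [m] is needed: without it the truncated subtraction [n - m]
   would give positive mass to [m > n]. *)
Definition hypergeom (R : realType) (gamma delta n m : nat) : R :=
  if (m <= minn n gamma)%N
  then ('C(gamma, m) * 'C(delta, n - m))%N%:R / 'C(gamma + delta, n)%:R
  else 0.

Lemma hypergeom_sum1 (R : realType) (gamma delta n : nat) :
  (n <= gamma + delta)%N ->
  \sum_(m < gamma.+1) hypergeom R gamma delta n m = 1.
Proof.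
move=> le_n; rewrite -(big_mkord xpredT (hypergeom R gamma delta n)).
have C_neq0 : 'C(gamma + delta, n)%:R != 0 :> R.
  by rewrite pnatr_eq0 -lt0n bin_gt0.
have trunc a : (minn n gamma <= a)%N ->
    \sum_(0 <= m < a.+1) hypergeom R gamma delta n m =
    \sum_(0 <= m < (minn n gamma).+1) hypergeom R gamma delta n m.
  move=> le_a; rewrite (big_cat_nat (n := (minn n gamma).+1)) //=.
  rewrite [X in _ + X]big_nat_cond [X in _ + X]big1 ?addr0 // => m.
  by rewrite andbT => /andP[lt_m _]; rewrite /hypergeom leqNgt lt_m.
rewrite trunc ?geq_minr // -(trunc n) ?geq_minl //.
rewrite -[RHS](divff C_neq0) -[in X in X / _]binomial.Vandermonde natr_sum mulr_suml big_mkord.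
apply: eq_bigr => -[m /=]; rewrite ltnS => le_m _.
rewrite /hypergeom leq_min le_m /=; case: leqP => // lt_m.
by rewrite (bin_small lt_m) mul0n mul0r.
Qed.

Definition state (gamma1 delta1 gamma2 delta2 : nat) : finType :=
  ('I_(gamma1 + delta1).+1 * 'I_(gamma2 + delta2).+1)%type.

(* By [riem_stable] below, for [gamma1 = gamma2] the [inord]s only truncate
   on outcomes of probability zero. *)
Definition riem (R : realType) (gamma1 delta1 gamma2 delta2 : nat)
    (f : state gamma1 delta1 gamma2 delta2 -> R)
    (n : state gamma1 delta1 gamma2 delta2) : R :=
  \sum_(k1 < gamma1.+1) \sum_(k2 < gamma2.+1)
    hypergeom R gamma1 delta1 n.1 k1 * hypergeom R gamma2 delta2 n.2 k2 *
    f (inord (k2 + (n.1 - k1))%N, inord (k1 + (n.2 - k2))%N).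

Lemma riem_stable (R : realType) (gamma delta1 delta2 n1 n2 k1 k2 : nat) :
  hypergeom R gamma delta1 n1 k1 != 0 ->
  hypergeom R gamma delta2 n2 k2 != 0 ->
  (k2 + (n1 - k1) <= gamma + delta1)%N /\
  (k1 + (n2 - k2) <= gamma + delta2)%N.
Proof.
have supp d n k :
    hypergeom R gamma d n k != 0 -> (k <= gamma)%N /\ (n - k <= d)%N.
  rewrite /hypergeom leq_min; case: ifP => [/andP[_ ->]|]; last by rewrite eqxx.
  case: (leqP (n - k) d) => // lt_d.
  by rewrite (bin_small lt_d) muln0 mul0r eqxx.
by move=> /supp[? ?] /supp[? ?]; split; apply: leq_add.
Qed.

Inductive su2_index := su2_plus | su2_minus | su2_zero.

Definition J (R : realType) (alpha : su2_index) (r : nat)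
    (f : 'I_r.+1 -> R) (n : 'I_r.+1) : R :=
  match alpha with
  | su2_plus => if (n < r)%N then (r%:R - n%:R) * f (inord n.+1) else 0
  | su2_minus => if (0 < n)%N then n%:R * f (inord n.-1) else 0
  | su2_zero => (r%:R / 2%:R - n%:R) * f n
  end.

Definition act_fst (R : realType) (S1 S2 : Type)
    (A : (S1 -> R) -> S1 -> R) (f : S1 * S2 -> R) (n : S1 * S2) : R :=
  A (fun m => f (m, n.2)) n.1.

Definition act_snd (R : realType) (S1 S2 : Type)
    (A : (S2 -> R) -> S2 -> R) (f : S1 * S2 -> R) (n : S1 * S2) : R :=
  A (fun m => f (n.1, m)) n.2.

Definition J_total (R : realType) (alpha : su2_index) (r1 r2 : nat)
    (f : 'I_r1.+1 * 'I_r2.+1 -> R) (n : 'I_r1.+1 * 'I_r2.+1) : R :=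
  act_fst (@J R alpha r1) f n + act_snd (@J R alpha r2) f n.

Definition operators_commute (R : realType) (S : Type)
    (A B : (S -> R) -> S -> R) : Prop :=
  forall f : S -> R, A (B f) =1 B (A f).

Definition self_dual (R : realType) (S : Type)
    (P : (S -> R) -> S -> R) (D : S -> S -> R) : Prop :=
  forall k n : S, P (fun k' => D k' n) k = P (fun n' => D k n') n.

Definition dual_factor (R : realType) (r k n : nat) : R :=
  if (k == 0)%N then 1
  else if (n < k)%N || (r < n)%N then 0
  else 'C(n, k)%:R / 'C(r, k)%:R.

Definition riem_dual (R : realType) (gamma1 delta1 gamma2 delta2 : nat)
    (k n : state gamma1 delta1 gamma2 delta2) : R :=
  dual_factor R (gamma1 + delta1) k.1 n.1 *
  dual_factor R (gamma2 + delta2) k.2 n.2.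

(* Main.v *)
(** Both parts rest on two intertwining relations. Let [splitE] be the
    expectation over the hypergeometric splitting [n = m + l], and call merging
    the map [f |-> fun m l => f (m + l)]. Then [riem] merges, exchanges, and
    applies [splitE] to each agent. Splitting and merging both intertwine
    the [J] operator of spin [gamma + delta] with the sum of those of spins
    [gamma] and [delta], and the exchange of the two parts of spin [gamma]
    preserves the total sum. The same two maps are dual to each other: averaging
    [d_gamma * d_delta] over the splitting of either argument merges the other
    one (Vandermonde), and the exchange is an involution. *)
Require Import Defs.
From HB Require Import structures.
From mathcomp Require Import all_boot all_order all_algebra.
From mathcomp Require Import reals.
From mathcomp Require Import zify ring.

Set Implicit Arguments.
Unset Strict Implicit.
Unset Printing Implicit Defensive.

Import Order.TTheory GRing.Theory Num.Theory.
Local Open Scope ring_scope.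

(** * Hypergeometric splitting on functions of natural numbers *)

Section Splitting.
Variable R : realType.
Implicit Types (r n m l : nat) (f : nat -> R) (g h : nat -> nat -> R).

(** Working on total functions over [nat] makes merging plain addition, free of casts between
    ordinals. *)
Definition splitE (gamma delta n : nat) (g : nat -> nat -> R) : R :=
  \sum_(m < gamma.+1) hypergeom R gamma delta n m * g m (n - m)%N.

(* No boundary cases: the coefficients vanish at [n = r], resp. [n = 0]. *)
Definition natJ (alpha : su2_index) (r : nat) (f : nat -> R) (n : nat) : R :=
  match alpha with
  | su2_plus => (r%:R - n%:R) * f n.+1
  | su2_minus => n%:R * f n.-1
  | su2_zero => (r%:R / 2%:R - n%:R) * f n
  end.

Lemma hypergeom_supp gamma delta n m :
  hypergeom R gamma delta n m != 0 ->
  [/\ (m <= n)%N, (m <= gamma)%N & (n - m <= delta)%N].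
Proof.
rewrite /hypergeom leq_min; case: ifP => [/andP[-> ->]|]; last by rewrite eqxx.
case: (leqP (n - m) delta) => // lt_d.
by rewrite (bin_small lt_d) muln0 mul0r eqxx.
Qed.

(** Splittings outside these bounds have zero weight. Every later range condition on the two parts
    comes from here. *)
Lemma eq_splitE gamma delta n g h :
  (forall m l, (m <= gamma)%N -> (l <= delta)%N -> (m + l = n)%N ->
     g m l = h m l) ->
  splitE gamma delta n g = splitE gamma delta n h.
Proof.
move=> eq_gh; apply: eq_bigr => m _.
have [->|/hypergeom_supp[le_mn le_m le_l]] :=
  eqVneq (hypergeom R gamma delta n m) 0; first by rewrite !mul0r.
by rewrite eq_gh // subnKC.
Qed.

Lemma splitED gamma delta n g h :
  splitE gamma delta n (fun m l => g m l + h m l) =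
  splitE gamma delta n g + splitE gamma delta n h.
Proof.
by rewrite /splitE -big_split; apply: eq_bigr => m _; rewrite mulrDr.
Qed.

Lemma splitEZ gamma delta n (c : R) g :
  splitE gamma delta n (fun m l => c * g m l) = c * splitE gamma delta n g.
Proof.
by rewrite /splitE mulr_sumr; apply: eq_bigr => m _; rewrite mulrCA.
Qed.

Lemma splitEC gamma delta n gamma' delta' n' (g : nat -> nat -> nat -> nat -> R) :
  splitE gamma delta n (fun m l => splitE gamma' delta' n' (g m l)) =
  splitE gamma' delta' n'
    (fun m' l' => splitE gamma delta n (fun m l => g m l m' l')).
Proof.
rewrite /splitE.
under eq_bigr do rewrite mulr_sumr.
rewrite exchange_big; apply: eq_bigr => m' _.
by rewrite mulr_sumr; apply: eq_bigr => m _; rewrite mulrCA.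
Qed.

Lemma natJ_splitE alpha r gamma delta n (g : nat -> nat -> nat -> R) n' :
  natJ alpha r (fun n' => splitE gamma delta n (fun m l => g m l n')) n' =
  splitE gamma delta n (fun m l => natJ alpha r (g m l) n').
Proof. by case: alpha; rewrite /natJ splitEZ. Qed.

(** Summing up to [n] instead of [gamma] gives the shape of a Vandermonde convolution; the terms
    beyond [minn n gamma] vanish on both sides. *)
Lemma splitE_bin gamma delta n g :
  splitE gamma delta n g =
  (\sum_(m < n.+1) 'C(gamma, m)%:R * 'C(delta, n - m)%:R * g m (n - m)%N) /
  'C(gamma + delta, n)%:R.
Proof.
pose F m : R :=
  if (m <= minn n gamma)%N
  then 'C(gamma, m)%:R * 'C(delta, n - m)%:R * g m (n - m)%N else 0.
have sumF a : (minn n gamma <= a)%N ->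
    \sum_(m < a.+1) F m = \sum_(m < (minn n gamma).+1) F m.
  move=> le_a; rewrite -!(big_mkord xpredT).
  rewrite (big_cat_nat (n := (minn n gamma).+1)) //=.
  rewrite [X in _ + X]big_nat_cond [X in _ + X]big1 ?addr0 // => m.
  by rewrite andbT => /andP[lt_m _]; rewrite /F leqNgt lt_m.
transitivity ((\sum_(m < gamma.+1) F m) / 'C(gamma + delta, n)%:R).
  rewrite mulr_suml; apply: eq_bigr => m _; rewrite /hypergeom /F.
  by case: ifP; rewrite ?mul0r // natrM => _; rewrite mulrAC.
congr (_ / _); rewrite (sumF gamma) ?geq_minr // -(sumF n) ?geq_minl //.
apply: eq_bigr => -[m /=]; rewrite ltnS => le_mn _.
rewrite /F leq_min le_mn /=; case: leqP => // lt_m.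
by rewrite (bin_small lt_m) !mul0r.
Qed.

(** * Intertwining of splitting and merging with the [J] operators *)

Lemma natr_bin_succ r n :
  n.+1%:R * 'C(r, n.+1)%:R = (r%:R - n%:R) * 'C(r, n)%:R :> R.
Proof.
case: (leqP n r) => [le_n|lt_r].
  by rewrite -natrB // -!natrM mul_bin_left.
by rewrite !bin_small ?mulr0 // ltnW.
Qed.

Lemma natr_bin_neq0 r n : (n <= r)%N -> 'C(r, n)%:R != 0 :> R.
Proof. by rewrite pnatr_eq0 -lt0n bin_gt0. Qed.

(** Write [n.+1] as [m + (n.+1 - m)] inside the sum and absorb each summand into its own binomial by
    [natr_bin_succ]. *)
Lemma sum_bin_raise gamma delta n g :
  n.+1%:R * (\sum_(m < n.+2)
    'C(gamma, m)%:R * 'C(delta, n.+1 - m)%:R * g m (n.+1 - m)%N) =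
  \sum_(m < n.+1) 'C(gamma, m)%:R * 'C(delta, n - m)%:R *
    ((gamma%:R - m%:R) * g m.+1 (n - m)%N +
     (delta%:R - (n - m)%:R) * g m (n - m).+1).
Proof.
have sum_split : n.+1%:R * (\sum_(m < n.+2)
    'C(gamma, m)%:R * 'C(delta, n.+1 - m)%:R * g m (n.+1 - m)%N) =
  (\sum_(m < n.+2) m%:R * 'C(gamma, m)%:R *
     ('C(delta, n.+1 - m)%:R * g m (n.+1 - m)%N)) +
  (\sum_(m < n.+2) (n.+1 - m)%:R * 'C(delta, n.+1 - m)%:R *
     ('C(gamma, m)%:R * g m (n.+1 - m)%N)).
  rewrite mulr_sumr -big_split; apply: eq_bigr => m _ /=.
  rewrite -{1}(subnKC (leq_ord m)) natrD; ring.
(* The first sum loses its zero term at [m = 0] and is shifted by one; the second loses its zero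
   term at [m = n.+1]. *)
rewrite sum_split big_ord_recl [X in _ + X]big_ord_recr /=.
rewrite subnn !mul0r addr0 add0r -big_split; apply: eq_bigr => m _ /=.
rewrite /bump leq0n add1n subSS natr_bin_succ.
rewrite (subSn (leq_ord m)) natr_bin_succ; ring.
Qed.

(** After a shift of the first sum, both parts of the right side evaluate [g] at [m] and [n - m].
    Absorption gives them the coefficients [gamma - m] and [delta - (n - m)], which add up to
    [gamma + delta - n]. *)
Lemma sum_bin_lower gamma delta n g :
  (gamma%:R + delta%:R - n%:R) * (\sum_(m < n.+1)
    'C(gamma, m)%:R * 'C(delta, n - m)%:R * g m (n - m)%N) =
  \sum_(m < n.+2) 'C(gamma, m)%:R * 'C(delta, n.+1 - m)%:R *
    (m%:R * g m.-1 (n.+1 - m)%N + (n.+1 - m)%:R * g m (n.+1 - m).-1).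
Proof.
under [RHS]eq_bigr do rewrite mulrDr.
rewrite big_split /= [X in _ = X + _]big_ord_recl [X in _ = _ + X]big_ord_recr.
rewrite /= subnn !mul0r !mulr0 addr0 add0r -big_split mulr_sumr.
apply: eq_bigr => m _ /=; have le_mn : (m <= n)%N := leq_ord m.
rewrite /bump leq0n add1n subSS (subSn le_mn) /=.
have -> : n%:R = m%:R + (n - m)%:R :> R by rewrite -natrD subnKC.
transitivity ((m.+1%:R * 'C(gamma, m.+1)%:R) * 'C(delta, n - m)%:R *
    g m (n - m)%N + 'C(gamma, m)%:R *
    ((n - m).+1%:R * 'C(delta, (n - m).+1)%:R) * g m (n - m)%N).
  by rewrite !natr_bin_succ; ring.
ring.
Qed.

(** For plus and minus, the two sum identities above match the numerators, and absorption for
    [gamma + delta] matches the normalising binomials. For zero, the eigenvalues add. *)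
Lemma splitE_natJ alpha gamma delta n g : (n <= gamma + delta)%N ->
  natJ alpha (gamma + delta) (fun n => splitE gamma delta n g) n =
  splitE gamma delta n
    (fun m l => natJ alpha gamma (g^~ l) m + natJ alpha delta (g m) l).
Proof.
move=> le_n; case: alpha => /=.
(* At the top value the binomial at [n.+1] is zero and cannot be cancelled; there the only splitting
   is [(gamma, delta)], which all raising coefficients kill. *)
- move: le_n; rewrite leq_eqVlt => /predU1P[-> | lt_n].
    rewrite subrr mul0r (@eq_splitE _ _ _ _ (fun _ _ => 0 * 0)).
      by rewrite splitEZ mul0r.
    move=> m l le_m le_l eq_ml; have [-> ->] : m = gamma /\ l = delta by lia.
    by rewrite !subrr !mul0r addr0.
  rewrite !splitE_bin -sum_bin_raise.
  have C0 := natr_bin_neq0 (ltnW lt_n); have C1 := natr_bin_neq0 lt_n.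
  have binE := natr_bin_succ (gamma + delta) n.
  set S := \sum_(_ < _) _.
  apply: (mulIf (mulf_neq0 C0 C1)).
  transitivity (((gamma + delta)%:R - n%:R) * 'C(gamma + delta, n)%:R * S);
    last rewrite -binE; by field.
- case: n le_n => [|n] lt_n.
    rewrite mul0r (@eq_splitE _ _ _ _ (fun _ _ => 0 * 0)).
      by rewrite splitEZ mul0r.
    move=> m l _ _ eq_ml; have [-> ->] : m = 0%N /\ l = 0%N by lia.
    by rewrite !mul0r addr0.
  rewrite /= !splitE_bin -sum_bin_lower -natrD.
  have C0 := natr_bin_neq0 (ltnW lt_n); have C1 := natr_bin_neq0 lt_n.
  have binE := natr_bin_succ (gamma + delta) n.
  set S := \sum_(_ < _) _.
  apply: (mulIf (mulf_neq0 C0 C1)).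
  transitivity (n.+1%:R * 'C(gamma + delta, n.+1)%:R * S);
    last rewrite binE; by field.
- rewrite -splitEZ; apply: eq_splitE => m l _ _ <-.
  by rewrite !natrD; field.
Qed.

Lemma natJ_merge alpha gamma delta f m l :
  natJ alpha gamma (fun m => f (m + l)%N) m +
  natJ alpha delta (fun l => f (m + l)%N) l =
  natJ alpha (gamma + delta) f (m + l).
Proof.
case: alpha => /=.
- by rewrite addSn addnS !natrD; ring.
- case: m l => [|m] [|l] /=; rewrite ?addn0 ?add0n ?mul0r ?addr0 ?add0r //.
  by rewrite addSn addnS /= -mulrDl -natrD addSn addnS.
- by rewrite !natrD; field.
Qed.

Definition nat_riem (gamma delta1 delta2 : nat) (F : nat -> nat -> R)
    (n1 n2 : nat) : R :=
  splitE gamma delta1 n1 (fun m1 l1 => splitE gamma delta2 n2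
    (fun m2 l2 => F (m2 + l1)%N (m1 + l2)%N)).

(** Both sides become a double splitting of four [natJ] terms, one for each part. The exchanged
    parts have the same spin [gamma], so the two sums differ only in their grouping. *)
Lemma nat_riem_natJ alpha gamma delta1 delta2 (F : nat -> nat -> R) n1 n2 :
  (n1 <= gamma + delta1)%N -> (n2 <= gamma + delta2)%N ->
  nat_riem gamma delta1 delta2
    (fun a b => natJ alpha (gamma + delta1) (F^~ b) a +
                natJ alpha (gamma + delta2) (F a) b) n1 n2 =
  natJ alpha (gamma + delta1)
    (fun n1 => nat_riem gamma delta1 delta2 F n1 n2) n1 +
  natJ alpha (gamma + delta2) (nat_riem gamma delta1 delta2 F n1) n2.
Proof.
move=> le_n1 le_n2; rewrite [X in _ = X + _]splitE_natJ //.
rewrite [X in _ = _ + X]natJ_splitE -splitED.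
apply: eq_splitE => m1 l1 _ _ _.
rewrite [X in _ = _ + X]splitE_natJ // !natJ_splitE -!splitED.
apply: eq_splitE => m2 l2 _ _ _.
rewrite -(natJ_merge _ _ _ (F^~ _)) -(natJ_merge _ _ _ (F _)) /=.
ring.
Qed.

(** * Duality between splitting and merging *)

Lemma dual_factorE r k n : (k <= r)%N -> (n <= r)%N ->
  dual_factor R r k n = 'C(n, k)%:R / 'C(r, k)%:R.
Proof.
move=> le_k le_n; rewrite /dual_factor.
case: eqP => [->|_]; first by rewrite !bin0 divr1.
rewrite [(r < n)%N]ltnNge le_n orbF; case: ltnP => // lt_k.
by rewrite bin_small // mul0r.
Qed.

(** The hypergeometric weight cancels the denominators of the dual factors, which leaves the
    Vandermonde sum for ['C(m + l, k)]. *)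
Lemma splitE_dual_l gamma delta k m l :
  (k <= gamma + delta)%N -> (m <= gamma)%N -> (l <= delta)%N ->
  splitE gamma delta k
    (fun i j => dual_factor R gamma i m * dual_factor R delta j l) =
  dual_factor R (gamma + delta) k (m + l).
Proof.
move=> le_k le_m le_l; rewrite dual_factorE ?leq_add //.
pose h i j : R := 'C(m, i)%:R / 'C(gamma, i)%:R * ('C(l, j)%:R / 'C(delta, j)%:R).
rewrite (eq_splitE (h := h)); last by move=> i j *; rewrite !dual_factorE.
rewrite splitE_bin; congr (_ / _).
rewrite -binomial.Vandermonde natr_sum; apply: eq_bigr => i _.
have binK r a c : (c <= r)%N -> 'C(r, a)%:R * ('C(c, a)%:R / 'C(r, a)%:R) =
    'C(c, a)%:R :> R.
  move=> le_c; case: (leqP a r) => [le_a|lt_r].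
    by rewrite mulrCA divff ?mulr1 ?natr_bin_neq0.
  by rewrite !bin_small ?mul0r ?mulr0 //; apply: leq_ltn_trans lt_r.
by rewrite /h mulrACA !binK // natrM.
Qed.

(** Both sides count pairs of nested subsets, of sizes [k] and [n], of a set of size [r]; the proof
    compares factorials. *)
Lemma mul_bin_bin r n k : (k <= n)%N ->
  ('C(r, n) * 'C(n, k) = 'C(r, k) * 'C(r - k, n - k))%N.
Proof.
move=> le_kn; case: (leqP n r) => [le_nr|lt_rn]; last first.
  by case: (leqP k r) => lt_kr; rewrite !(bin_small lt_rn) ?(bin_small lt_kr) //
    (@bin_small (r - k)) ?muln0 //; lia.
have subE : (r - k - (n - k) = r - n)%N by lia.
have nE := bin_fact le_nr; have kE := bin_fact le_kn.
have rE := bin_fact (leq_trans le_kn le_nr).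
have dE : (n - k <= r - k)%N by lia.
move/bin_fact: dE; rewrite subE => dE.
apply/eqP; rewrite -(@eqn_pmul2r (k`! * (n - k)`! * (r - n)`!)).
  by apply/eqP; rewrite -kE in nE; rewrite -dE in rE; nia.
by rewrite !muln_gt0 !fact_gt0.
Qed.

Lemma bin_dual_factor r m k : (k <= r)%N -> (k <= m)%N ->
  'C(r, m)%:R * ('C(m, k)%:R / 'C(r, k)%:R) = 'C(r - k, m - k)%:R :> R.
Proof.
move=> le_kr le_km; rewrite mulrA -natrM mul_bin_bin // natrM mulrAC.
by rewrite divff ?mul1r ?natr_bin_neq0.
Qed.

(** By [bin_dual_factor], weight times dual factors is ['C(gamma - i, m - i) * 'C(delta - j, n - m -
    j)], again a Vandermonde sum. The same identity for [gamma + delta] identifies its value. *)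
Lemma splitE_dual_r gamma delta n i j :
  (n <= gamma + delta)%N -> (i <= gamma)%N -> (j <= delta)%N ->
  splitE gamma delta n
    (fun m l => dual_factor R gamma i m * dual_factor R delta j l) =
  dual_factor R (gamma + delta) (i + j) n.
Proof.
move=> le_n le_i le_j; rewrite dual_factorE ?leq_add //.
pose h m l : R := 'C(m, i)%:R / 'C(gamma, i)%:R * ('C(l, j)%:R / 'C(delta, j)%:R).
rewrite (eq_splitE (h := h)); last by move=> m l *; rewrite !dual_factorE.
rewrite splitE_bin.
pose T m : R := 'C(gamma, m)%:R * 'C(delta, n - m)%:R * h m (n - m)%N.
(* Only the window from [i] to [n - j] contributes; it is empty when [n < i + j]. *)
have T0 m : (m < i)%N || (n - m < j)%N -> T m = 0.
  by rewrite /T /h => /orP[] /bin_small->; rewrite !(mul0r, mulr0).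
rewrite -(big_mkord xpredT T).
case: (leqP (i + j) n) => [le_ij|lt_ij]; last first.
  rewrite (bin_small lt_ij) mul0r big1_seq ?mul0r // => m /=.
  by rewrite mem_index_iota => lt_m; apply: T0; lia.
have sumT : \sum_(0 <= m < n.+1) T m = 'C(gamma + delta - (i + j), n - (i + j))%:R.
  rewrite (@big_cat_nat _ _ _ i) //=; last by lia.
  rewrite big_nat_cond big1 ?add0r; last first.
    by move=> m; rewrite andbT => /andP[_ lt_m]; rewrite T0 ?lt_m.
  rewrite (@big_cat_nat _ _ _ (n - j).+1) //=; [|lia|lia].
  rewrite [X in _ + X]big_nat_cond [X in _ + X]big1 ?addr0; last first.
    by move=> m; rewrite andbT => lt_m; apply: T0; lia.
  rewrite -{1}[i]add0n big_addn subSn; last by lia.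
  have -> : (n - j - i = n - (i + j))%N by lia.
  have -> : (gamma + delta - (i + j) = (gamma - i) + (delta - j))%N by lia.
  rewrite -binomial.Vandermonde natr_sum big_mkord; apply: eq_bigr => p _.
  have lt_p := ltn_ord p; rewrite /T /h mulrACA !bin_dual_factor //; try lia.
  by rewrite natrM; congr ('C(_, _)%:R * 'C(_, _)%:R); lia.
rewrite sumT -bin_dual_factor ?leq_add //.
by rewrite mulrC mulKf ?natr_bin_neq0.
Qed.

(** Split [n1] and [n2] by [splitE_dual_r], interchange the expectations, and recombine the
    splittings of [k1] and [k2] by [splitE_dual_l]. *)
Lemma nat_riem_dual gamma delta1 delta2 k1 k2 n1 n2 :
  (k1 <= gamma + delta1)%N -> (k2 <= gamma + delta2)%N ->
  (n1 <= gamma + delta1)%N -> (n2 <= gamma + delta2)%N ->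
  nat_riem gamma delta1 delta2 (fun a b =>
    dual_factor R (gamma + delta1) a n1 *
    dual_factor R (gamma + delta2) b n2) k1 k2 =
  nat_riem gamma delta1 delta2 (fun a b =>
    dual_factor R (gamma + delta1) k1 a *
    dual_factor R (gamma + delta2) k2 b) n1 n2.
Proof.
move=> le_k1 le_k2 le_n1 le_n2.
pose d := dual_factor R.
(* The exchange pairs [i2] with [m1] and [i1] with [m2]. This pairing is the same whether the [k]
   parts or the [n] parts are exchanged. *)
pose G i1 j1 i2 j2 m1 l1 m2 l2 : R :=
  d gamma i2 m1 * d delta1 j1 l1 * (d gamma i1 m2 * d delta2 j2 l2).
transitivity (splitE gamma delta1 k1 (fun i1 j1 => splitE gamma delta2 k2
  (fun i2 j2 => splitE gamma delta1 n1 (fun m1 l1 => splitE gamma delta2 n2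
    (fun m2 l2 => G i1 j1 i2 j2 m1 l1 m2 l2))))).
  apply: eq_splitE => i1 j1 le_i1 le_j1 _; apply: eq_splitE => i2 j2 le_i2 le_j2 _.
  rewrite -!splitE_dual_r // mulrC -splitEZ.
  apply: eq_splitE => m1 l1 _ _ _; rewrite mulrC -splitEZ.
  by apply: eq_splitE.
transitivity (splitE gamma delta1 n1 (fun m1 l1 => splitE gamma delta2 n2
  (fun m2 l2 => splitE gamma delta1 k1 (fun i1 j1 => splitE gamma delta2 k2
    (fun i2 j2 => G i1 j1 i2 j2 m1 l1 m2 l2))))).
  under eq_splitE => i1 j1 _ _ _ do rewrite splitEC.
  rewrite splitEC; apply: eq_splitE => m1 l1 _ _ _.
  under eq_splitE => i1 j1 _ _ _ do rewrite splitEC.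
  by rewrite splitEC.
apply: eq_splitE => m1 l1 le_m1 le_l1 _; apply: eq_splitE => m2 l2 le_m2 le_l2 _.
rewrite -!splitE_dual_l // mulrC -splitEZ.
apply: eq_splitE => i1 j1 _ _ _; rewrite mulrC -splitEZ.
by apply: eq_splitE => i2 j2 _ _ _; rewrite /G /d; ring.
Qed.

End Splitting.

(** * Transfer to the finite state space *)

Lemma riemE (R : realType) (gamma delta1 delta2 : nat)
    (f : state gamma delta1 gamma delta2 -> R) (F : nat -> nat -> R) n :
  (forall a b, (a <= gamma + delta1)%N -> (b <= gamma + delta2)%N ->
     f (inord a, inord b) = F a b) ->
  riem f n = nat_riem gamma delta1 delta2 F n.1 n.2.
Proof.
move=> fE; transitivity (nat_riem gamma delta1 delta2
  (fun a b => f (inord a, inord b)) n.1 n.2).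
  rewrite /riem /nat_riem /splitE; apply: eq_bigr => k1 _.
  by rewrite mulr_sumr; apply: eq_bigr => k2 _; rewrite mulrA.
apply: eq_splitE => m1 l1 le_m1 le_l1 _; apply: eq_splitE => m2 l2 le_m2 le_l2 _.
by rewrite fE // leq_add.
Qed.

Lemma J_natJ (R : realType) alpha r (f : 'I_r.+1 -> R) (n : 'I_r.+1) :
  J alpha f n = natJ alpha r (fun m => f (inord m)) n.
Proof.
have le_n : (n <= r)%N := leq_ord n.
case: alpha; rewrite /= ?inord_val //.
- by case: ltngtP le_n => // -> _; rewrite subrr mul0r.
- by case: posnP => // ->; rewrite mul0r.
Qed.

(** Agreement up to [r] suffices: raising at [n = r] reads the value at [r.+1], but with coefficient
    zero. *)
Lemma eq_natJ (R : realType) alpha r (f g : nat -> R) n : (n <= r)%N ->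
  (forall m, (m <= r)%N -> f m = g m) -> natJ alpha r f n = natJ alpha r g n.
Proof.
move=> le_n eq_fg; case: alpha => /=; last by rewrite eq_fg.
  move: le_n; rewrite leq_eqVlt => /predU1P[->|/eq_fg -> //].
  by rewrite subrr !mul0r.
by rewrite eq_fg // (leq_trans (leq_pred n)).
Qed.

Theorem theorem3p2 (R : realType) (gamma gamma1 delta1 gamma2 delta2 : nat)
  (gamma1_gt0 : (0 < gamma1)%N) (delta1_gt0 : (0 < delta1)%N)
  (gamma2_gt0 : (0 < gamma2)%N) (delta2_gt0 : (0 < delta2)%N)
  (gamma1E : gamma1 = gamma) (gamma2E : gamma2 = gamma) :
  (forall alpha : su2_index,
     operators_commute (@riem R gamma1 delta1 gamma2 delta2)
       (@J_total R alpha (gamma1 + delta1) (gamma2 + delta2))) /\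
  self_dual (@riem R gamma delta1 gamma delta2)
    (@riem_dual R gamma delta1 gamma delta2).
Proof.
split=> [alpha f [n1 n2]|[k1 k2] [n1 n2]].
  subst gamma1 gamma2; pose F a b := f (inord a, inord b).
  have riemF n : riem f n = nat_riem gamma delta1 delta2 F n.1 n.2.
    by apply: riemE.
  (* The witness is the [nat] version of [J_total] applied to [f]; [F] may be arbitrary outside the
     state space. *)
  rewrite (@riemE _ _ _ _ _ (fun a b =>
    natJ alpha (gamma + delta1) (F^~ b) a + natJ alpha (gamma + delta2) (F a) b)).
    rewrite nat_riem_natJ ?leq_ord // /J_total /act_fst /act_snd !J_natJ.
    congr (_ + _); apply: eq_natJ; rewrite ?leq_ord // => m le_m;
    by rewrite riemF /= inordK.
  move=> a b le_a le_b; rewrite /J_total /act_fst /act_snd !J_natJ /=.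
  by rewrite !inordK.
rewrite (@riemE _ _ _ _ _ (fun a b => dual_factor R (gamma + delta1) a n1 *
    dual_factor R (gamma + delta2) b n2)); last first.
  by move=> a b le_a le_b; rewrite /riem_dual /= !inordK.
rewrite nat_riem_dual ?leq_ord //; apply/esym/riemE => a b le_a le_b.
by rewrite /riem_dual /= !inordK.
Qed.
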